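(* $R_{(5,5)} \leq 0.1689325$, $R_{(6,5)} \leq 0.3451130$, and $R_{(6,6)} \leq \frac{5}{59}$.
   Context: For integers $b \geq k$ and $n$, a $(b,k)$-hash code of length $n$ is a subset $\mathcal{C} \subseteq \{1,2,\ldots,b\}^n$ such that for any $k$ distinct elements of $\mathcal{C}$ there is a coordinate $i \in \{1,\ldots,n\}$ in which their $i$-th entries are pairwise distinct. Let $N_{(b,k)}(n)$ denote the maximum size of a $(b,k)$-hash code of length $n$, and define $R_{(b,k)} = \limsup_{n\to\infty} \frac{1}{n}\log_2 N_{(b,k)}(n)$. *)

(* Defs.v *)
From HB Require Import structures.
From mathcomp Require Import all_boot all_order all_algebra.
From mathcomp Require Import all_classical all_reals.
From mathcomp Require Import ereal sequences exp.
Set Implicit Arguments. Unset Strict Implicit. Unset Printing Implicit Defensive.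
Import Order.TTheory GRing.Theory Num.Theory.
Local Open Scope ring_scope.

Definition word (b n : nat) := {ffun 'I_n -> 'I_b}.

Definition is_hash_code (b k n : nat) (C : {set word b n}) : Prop :=
  forall S : {set word b n}, S \subset C -> #|S| = k ->
    exists i : 'I_n, {in S &, injective (fun x : word b n => x i)}.

Definition N_hash (b k n : nat) : nat :=
  \max_(C : {set word b n} | `[< is_hash_code k C >]) #|C|.

Definition R_hash (R : realType) (b k : nat) : \bar R :=
  limn_esup (fun n : nat =>
    ((ln ((N_hash b k n)%:R : R) / ln 2) / n%:R)%:E).

(* Main.v *)
Require Import Defs.
From HB Require Import structures.
From mathcomp Require Import all_boot all_order all_algebra.
From mathcomp Require Import all_classical all_reals.
From mathcomp Require Import ereal normedtype sequences exp.
From mathcomp Require Import ring lra zify.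
Set Implicit Arguments. Unset Strict Implicit. Unset Printing Implicit Defensive.
Import Order.TTheory GRing.Theory Num.Theory.
Local Open Scope ring_scope.

(** Let [d = k - 3] and [j = k - 2].  Sample [j] codewords from a random box
    that allows only [d] symbols in each of the first [l] coordinates.  Two of
    them agree in each of these coordinates, so every two further codewords are
    separated, together with the sample, in one of the remaining [n - l]
    coordinates, and Hansel's lemma bounds [ln (#|C| - j)] by [ln (b - j)] times
    the expected number of such coordinates per codeword.

    In one coordinate, let [p] be the symbol distribution in the box, [q] its
    average over the boxes and [g_a p] the probability that [j] samples from [p]
    are distinct and avoid [a].  One must bound the average of
    [\sum_a g_a p * q a].  Write [gamma] for [g p] minus its mean, and
    [x = p - 1/b], [y = q - 1/b].  From [0 <= |gamma + c x - 2 c y|^2],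
    [\sum_a g_a p * q a <= F p + c <y, q - p>] with
    [F p = mean (g p) + |gamma + c x|^2 / (4 c)], and the last term averages to
    zero.  With the sum of two entries of [p] fixed, [F] is a convex quadratic
    function of their product, so its maximum over the simplex is attained at a
    uniform distribution on some set of symbols, which leaves a finite check.
    Both bounds combine, with [(b / d) ^ l] slightly below [#|C|], into a rate
    [mu lam / (mu + lam)] where [mu = M ln (b - j)] and [lam = ln (b / d)]. *)

(** * Maximising a function over the simplex by moving mass between two entries *)

Section Smoothing.
Variables (R : realFieldType) (T : finType).
Implicit Types (p q : {ffun T -> R}) (A D S : {set T}).

Definition in_simplex p := (forall a, 0 <= p a) /\ \sum_a p a = 1.
Definition unif D : {ffun T -> R} := [ffun a => if a \in D then #|D|%:R^-1 else 0].

Definition same_sum_off (i j : T) p p' :=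
  (forall a, a != i -> a != j -> p' a = p a) /\ p' i + p' j = p i + p j.

Definition affine_in_product i j p (F : {ffun T -> R} -> R) :=
  exists x y : R, forall p', same_sum_off i j p p' -> F p' = x * (p' i * p' j) + y.

Definition convex_in_product i j p (F : {ffun T -> R} -> R) :=
  exists x y z : R, 0 <= x /\ forall p', same_sum_off i j p p' ->
    F p' = x * (p' i * p' j) ^+ 2 + y * (p' i * p' j) + z.

Definition upd2 p i j u v : {ffun T -> R} :=
  [ffun a => if a == i then u else if a == j then v else p a].

Lemma upd2_off p i j u v : i != j -> u + v = p i + p j ->
  same_sum_off i j p (upd2 p i j u v).
Proof.
move=> ij uv; split=> [a ai aj|]; first by rewrite ffunE (negbTE ai) (negbTE aj).
by rewrite !ffunE eqxx [j == i]eq_sym (negbTE ij) eqxx.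
Qed.

Lemma simplex_upd2 p i j u v : in_simplex p -> i != j -> 0 <= u -> 0 <= v ->
  u + v = p i + p j -> in_simplex (upd2 p i j u v).
Proof.
move=> [p0 p1] ij u0 v0 uv; split=> [a|].
  by rewrite ffunE; case: ifP => // _; case: ifP.
have ji : j != i by rewrite eq_sym.
have [E1 E2] := upd2_off ij uv.
rewrite -p1 (bigD1 i) //= (bigD1 j) //= addrA E2.
rewrite [RHS](bigD1 i) //= [X in _ = _ + X](bigD1 j) //= addrA; congr (_ + _).
by apply: eq_bigr => a /andP[ai aj]; rewrite E1.
Qed.

Definition supp p : {set T} := [set a | p a != 0].

(** A convex function on [[0, r]] lies below its chord. After multiplication by [r] the gap between
    chord and function is exactly [x * (r * t * (r - t))]. *)
Lemma convex_max (x y z t r M : R) : 0 <= x -> 0 <= t -> t <= r ->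
  z <= M -> x * r ^+ 2 + y * r + z <= M -> x * t ^+ 2 + y * t + z <= M.
Proof.
move=> x0 t0 tr h0 h1; case: (eqVneq r 0) => [r0|rn].
  have -> : t = 0 by lra.
  by rewrite expr0n !mulr0 !add0r.
have rp : 0 < r by rewrite lt_def rn; lra.
rewrite -(ler_pM2l rp).
have H1 : 0 <= (r - t) * (M - z) by apply: mulr_ge0; lra.
have H2 : 0 <= t * (M - (x * r ^+ 2 + y * r + z)) by apply: mulr_ge0; lra.
have H3 : 0 <= x * (r * t * (r - t)) by rewrite !mulr_ge0 //; lra.
rewrite -subr_ge0.
have -> : r * M - r * (x * t ^+ 2 + y * t + z) =
  (r - t) * (M - z) + t * (M - (x * r ^+ 2 + y * r + z)) + x * (r * t * (r - t)) by ring.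
by rewrite !addr_ge0.
Qed.

(** The deviations from [1 / #|supp p|] over the support sum to zero and are not all zero, so both
    signs occur. *)
Lemma unbalanced_pair p : in_simplex p -> p != unif (supp p) ->
  exists i j, p i < #|supp p|%:R^-1 /\ #|supp p|%:R^-1 < p j /\ 0 < p i.
Proof.
move=> [p0 p1] pu; set D := supp p; set r := _^-1.
have D0 : D != finset.set0.
  apply/eqP => DE; move: p1; rewrite big1 => [/eqP|a _]; first by rewrite eq_sym oner_eq0.
  by have := finset.in_set0 a; rewrite -DE inE => /negbFE/eqP.
have sD : \sum_(a in D) (p a - r) = 0.
  rewrite sumrB sumr_const -[_ *+ _]mulr_natl mulfV ?pnatr_eq0 ?cards_eq0 //.
  apply/eqP; rewrite subr_eq0 -p1 [X in _ == X](bigID (mem D)) /= [X in _ == _ + X]big1 ?addr0 // => a.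
  by rewrite inE negbK => /eqP.
have Dp a : (a \in D) = (0 < p a) by rewrite inE lt_def p0 andbT.
have [a aD ra] : exists2 a, a \in D & p a != r.
  apply/exists_inP; apply: contraT; rewrite negb_exists_in => /forall_inP h.
  case/eqP: pu; apply/ffunP => a; rewrite ffunE; case: ifP => aD.
    by apply/eqP; have := h _ aD; rewrite negbK.
  by move: aD; rewrite inE => /negbFE/eqP.
have [/exists_inP[i iD hi]|] := boolP [exists i in D, p i < r]; last first.
  rewrite negb_exists_in => /forall_inP h; move/eqP: sD; rewrite psumr_eq0; last first.
    by move=> x /h; rewrite -leNgt subr_ge0.
  by move/allP/(_ a); rewrite mem_index_enum aD subr_eq0 (negbTE ra) => /(_ isT).
have [/exists_inP[j jD hj]|] := boolP [exists j in D, r < p j]; last first.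
  rewrite negb_exists_in => /forall_inP h; move/eqP: sD; rewrite -oppr_eq0 -sumrN psumr_eq0; last first.
    by move=> x /h; rewrite -leNgt oppr_ge0 subr_le0.
  by move/allP/(_ a); rewrite mem_index_enum aD oppr_eq0 subr_eq0 (negbTE ra) => /(_ isT).
by exists i, j; rewrite -Dp.
Qed.

(** For [p i < r < p j] with [r = 1 / #|supp p|], emptying [i] into [j] makes the product 0, and
    raising entry [i] to [r] makes it [r * (p i + p j - r)]; the product at [p] lies in between. The
    first move shrinks the support, the second keeps it and leaves fewer entries different from [r].
    Convexity in the product bounds [F p] by the larger of the two values. *)
Lemma smoothing (F : {ffun T -> R} -> R) (M : R) :
  (forall p i j, i != j -> convex_in_product i j p F) ->
  (forall D, D != finset.set0 -> F (unif D) <= M) ->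
  forall p, in_simplex p -> F p <= M.
Proof.
move=> Fconv Funif p.
pose off p := [set a in supp p | p a != #|supp p|%:R^-1].
(* Lexicographic measure: since [off] has at most [#|T|] elements, the weight [#|T|.+1] lets a
   smaller support outweigh any change in [off]. *)
have [n] := ubnP (#|supp p| * #|T|.+1 + #|off p|).
elim: n p => // n IHn p; rewrite ltnS => hn ps; have [p0 p1] := ps.
have [pE|pu] := eqVneq p (unif (supp p)).
  rewrite pE; apply: Funif; apply/eqP => DE; move: p1; rewrite big1 => [/eqP|a _].
    by rewrite eq_sym oner_eq0.
  by have := finset.in_set0 a; rewrite -DE inE => /negbFE/eqP.
have [i [j [hi [hj pi0]]]] := unbalanced_pair ps pu.
set r := #|supp p|%:R^-1 in hi hj.
have ij : i != j by apply/eqP => E; move: hi hj; rewrite E => h1 /(lt_trans h1); rewrite ltxx.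
have iD : i \in supp p by rewrite inE gt_eqF.
have jD : j \in supp p by rewrite inE gt_eqF //; lra.
have ji : j != i by rewrite eq_sym.
have offT q : (#|off q| <= #|T|)%N by apply: max_card.
pose q0 := upd2 p i j 0 (p i + p j); pose q1 := upd2 p i j r (p i + p j - r).
have E0 : same_sum_off i j p q0 by apply: upd2_off => //; ring.
have E1 : same_sum_off i j p q1 by apply: upd2_off => //; ring.
have M0 : F q0 <= M.
  apply: IHn; last by apply: simplex_upd2 => //; [have := p0 j; lra|ring].
  have : (#|supp q0| < #|supp p|)%N.
    rewrite (cardsD1 i (supp p)) iD ltnS; apply: subset_leq_card.
    apply/fintype.subsetP => a; rewrite !inE ffunE; case: (a == i); rewrite ?eqxx //=.
    by have [->|_ //] := eqVneq a j; rewrite inE in jD.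
  by have := offT q0; nia.
have M1 : F q1 <= M.
  apply: IHn; last by apply: simplex_upd2 => //; [lra|lra|ring].
  have sE : supp q1 = supp p.
    apply/setP => a; rewrite !inE ffunE; have [->|_] := eqVneq a i.
      by rewrite !gt_eqF //; lra.
    by have [->|//] := eqVneq a j; rewrite !gt_eqF //; lra.
  apply: leq_trans hn; rewrite sE ltn_add2l; apply: proper_card; apply/properP; split.
    apply/fintype.subsetP => a; rewrite !inE sE ffunE; have [->|ai] := eqVneq a i; first by rewrite eqxx andbF.
    by have [->|//] := eqVneq a j => /andP[_ _]; rewrite !gt_eqF //; lra.
  exists i; first by rewrite !inE gt_eqF //= lt_eqF.
  by rewrite inE sE ffunE eqxx eqxx andbF.
have [x [y [z [x0 h]]]] := Fconv p i j ij.
have hp : same_sum_off i j p p by split.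
rewrite (h _ hp); apply: (@convex_max _ _ _ _ (r * (p i + p j - r))) => //.
- by apply: mulr_ge0; lra.
- rewrite -subr_ge0; have -> : r * (p i + p j - r) - p i * p j = (r - p i) * (p j - r) by ring.
  by apply: mulr_ge0; lra.
- by move: M0; rewrite (h _ E0) !ffunE eqxx mul0r expr0n !mulr0 !add0r.
by move: M1; rewrite (h _ E1) !ffunE eqxx (negbTE ji) eqxx.
Qed.

End Smoothing.

(** * Elementary symmetric polynomials over subsets of the alphabet *)

Section ElementarySymmetric.
Variables (R : realFieldType) (T : finType).
Implicit Types (p q : {ffun T -> R}) (A D S : {set T}).

Definition elsym p A j : R :=
  \sum_(S : {set T} | (S \subset A) && (#|S| == j)) \prod_(a in S) p a.

Lemma elsym0 p A : elsym p A 0 = 1.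
Proof.
rewrite /elsym (big_pred1 finset.set0) ?big_set0 // => S /=.
by rewrite cards_eq0; case: eqVneq => [->|]; rewrite ?finset.sub0set ?andbF.
Qed.

Lemma elsymS p A a j : a \in A ->
  elsym p A j.+1 = elsym p (A :\ a) j.+1 + p a * elsym p (A :\ a) j.
Proof.
move=> aA; rewrite /elsym (bigID (fun S => a \notin S)) /=; congr (_ + _).
  apply: eq_bigl => S; by rewrite subsetD1 andbAC.
rewrite big_distrr /= (reindex_onto (fun S => a |: S) (fun S => S :\ a)) /=; last first.
  by move=> S /andP[_]; rewrite negbK => /finset.setD1K.
apply: eq_big => [S|S /andP[_ /eqP E]]; last first.
  by rewrite big_setU1 //= -E !inE eqxx.
rewrite setU11 andbT subsetD1 finset.subUset finset.sub1set aA /=.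
have [aS|aS] := boolP (a \in S).
  rewrite andbF /=; apply/negbTE/negP => /andP[_ /eqP E].
  by move: aS; rewrite -E !inE eqxx.
by rewrite andbT setU1K // eqxx andbT cardsU1 aS.
Qed.

Lemma eq_esym p p' A j : {in A, p =1 p'} -> elsym p A j = elsym p' A j.
Proof.
move=> E; apply: eq_bigr => S /andP[/fintype.subsetP SA _].
by apply: eq_bigr => a /SA /E.
Qed.

Lemma elsym_scale p A j s : elsym [ffun a => s * p a] A j = s ^+ j * elsym p A j.
Proof.
rewrite /elsym big_distrr /=; apply: eq_bigr => S /andP[_ /eqP <-].
rewrite -prodr_const -big_split /=; apply: eq_bigr => a _; by rewrite ffunE.
Qed.

Lemma elsym_unif D A j : elsym (unif R D) A j = 'C(#|A :&: D|, j)%:R / #|D|%:R ^+ j.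
Proof.
rewrite /elsym (bigID (fun S => S \subset D)) /= [X in _ + X]big1 ?addr0; last first.
  move=> S /andP[_ /subsetPn[a aS aD]]; rewrite (bigD1 a) //= ffunE (negbTE aD).
  by rewrite mul0r.
rewrite -[in RHS]exprVn -cards_draws -sumr_const mulr_suml big_mkcond [RHS]big_mkcond /=.
apply: eq_bigr => S _; rewrite inE finset.subsetI.
have -> : (S \subset A) && (#|S| == j) && (S \subset D) =
          (S \subset A) && (S \subset D) && (#|S| == j).
  by rewrite -!andbA; congr (_ && _); rewrite andbC.
case: ifP => // /andP[/andP[_ /fintype.subsetP SD] /eqP <-].
rewrite mul1r -prodr_const; apply: eq_bigr => a /SD aD; by rewrite ffunE aD.
Qed.

(* Both sides count ordered selections: fixing the range [S] of an injective
   [t : 'I_j -> A] leaves [j!] choices. *)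
Lemma sum_injective_elsym p A j :
  \sum_(t : {ffun 'I_j -> T} | injectiveb t && [forall l, t l \in A])
     \prod_l p (t l) = j`!%:R * elsym p A j.
Proof.
rewrite (partition_big (fun t : {ffun 'I_j -> T} => [set t l | l in 'I_j])
   (fun S => (S \subset A) && (#|S| == j))) /=; last first.
  move=> t /andP[/injectiveP ti /forallP tA]; apply/andP; split.
    by apply/fintype.subsetP => _ /imsetP[l _ ->].
  by rewrite card_imset // card_ord.
rewrite big_distrr /=; apply: eq_bigr => S /andP[SA /eqP Sj].
have im (t : {ffun 'I_j -> T}) : injectiveb t -> [forall l, t l \in S] -> [set t l | l in 'I_j] = S.
  move=> /injectiveP ti /forallP tS; apply/eqP; rewrite eqEcard card_imset // card_ord Sj leqnn andbT.
  by apply/fintype.subsetP => _ /imsetP[l _ ->].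
transitivity (\sum_(t in [set f in ffun_on (mem S) | injectiveb (f : {ffun 'I_j -> T})]) \prod_(a in S) p a).
  apply: eq_big => [t|t /andP[/andP[/injectiveP ti _] /eqP <-]]; last first.
    by rewrite big_imset //= => a b _ _ /ti.
  rewrite inE; apply/idP/idP.
    move=> /andP[/andP[ti _] /eqP E]; rewrite ti andbT; apply/ffun_onP => l.
    by rewrite -E; apply/imsetP; exists l.
  move=> /andP[/ffun_onP tS ti]; rewrite ti /=.
  rewrite im //; last exact/forallP.
  by rewrite eqxx andbT; apply/forallP => l; apply: (fintype.subsetP SA); apply: tS.
by rewrite sumr_const card_inj_ffuns_on card_ord Sj ffactnn mulr_natl.
Qed.

End ElementarySymmetric.

(** * Closure properties of functions affine or convex in the product of two entries *)

Section PairwiseShape.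
Variables (R : realFieldType) (T : finType) (i j : T) (p : {ffun T -> R}).
Hypothesis ij : i != j.
Implicit Types (F G : {ffun T -> R} -> R).
Let affine := affine_in_product i j p.
Let convex := convex_in_product i j p.

Lemma affine_const (k : R) F : (forall p', same_sum_off i j p p' -> F p' = k) -> affine F.
Proof. by move=> h; exists 0, k => p' /h ->; ring. Qed.

Lemma affineD F G : affine F -> affine G -> affine (fun p => F p + G p).
Proof.
move=> [x [y h]] [x' [y' h']]; exists (x + x'), (y + y') => p' e.
by rewrite h // h' //; ring.
Qed.

Lemma affineZ k F : affine F -> affine (fun p => k * F p).
Proof. by move=> [x [y h]]; exists (k * x), (k * y) => p' e; rewrite h //; ring. Qed.

Lemma affine_sum (P : pred T) (F : T -> {ffun T -> R} -> R) :
  (forall a, P a -> affine (F a)) -> affine (fun p => \sum_(a | P a) F a p).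
Proof.
(* Each index has its own coefficients; induction on the list of indices collects them into one
   function [X]. *)
move=> h; have [X hX] : exists X : T -> R * R, forall a, P a ->
    forall p', same_sum_off i j p p' -> F a p' = (X a).1 * (p' i * p' j) + (X a).2.
  suff gen (s : seq T) : exists X : T -> R * R, forall a, a \in s -> P a ->
    forall p', same_sum_off i j p p' -> F a p' = (X a).1 * (p' i * p' j) + (X a).2.
    by have [X hX] := gen (enum T); exists X => a; apply: hX; rewrite mem_enum.
  elim: s => [|a s [X hX]]; first by exists (fun=> (0, 0)).
  have [Pa|nPa] := boolP (P a); last first.
    exists X => c; rewrite inE => /predU1P[->|]; last exact: hX.
    by rewrite (negbTE nPa).
  have [x [y hxy]] := h _ Pa.
  exists (fun c => if c == a then (x, y) else X c) => c; rewrite inE.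
  by case: eqVneq => [->|_] //= cs; apply: hX.
exists (\sum_(a | P a) (X a).1), (\sum_(a | P a) (X a).2) => p' e.
rewrite mulr_suml -big_split; apply: eq_bigr => a Pa; exact: hX.
Qed.

Lemma affine_convex F : affine F -> convex F.
Proof. by move=> [x [y h]]; exists 0, x, y; split=> // p' /h ->; ring. Qed.

Lemma convexD F G : convex F -> convex G -> convex (fun p => F p + G p).
Proof.
move=> [x [y [z [x0 h]]]] [x' [y' [z' [x0' h']]]].
exists (x + x'), (y + y'), (z + z'); split; first exact: addr_ge0.
by move=> p' e; rewrite h // h' //; ring.
Qed.

Lemma convexZ k F : 0 <= k -> convex F -> convex (fun p => k * F p).
Proof.
move=> k0 [x [y [z [x0 h]]]]; exists (k * x), (k * y), (k * z); split; first exact: mulr_ge0.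
by move=> p' e; rewrite h //; ring.
Qed.

Lemma convex_ext F G : (forall p', same_sum_off i j p p' -> F p' = G p') -> convex G -> convex F.
Proof.
move=> E [x [y [z [x0 h]]]]; exists x, y, z; split=> // p' e; by rewrite E // h.
Qed.

Lemma affine_ext F G : (forall p', same_sum_off i j p p' -> F p' = G p') -> affine G -> affine F.
Proof. by move=> E [x [y h]]; exists x, y => p' e; rewrite E // h. Qed.

Lemma affine_sqr F : affine F -> convex (fun p => F p ^+ 2).
Proof.
move=> [x [y h]]; exists (x ^+ 2), (2 * x * y), (y ^+ 2); split; first exact: sqr_ge0.
by move=> p' e; rewrite h //; ring.
Qed.

Lemma convex_sum (s : seq T) (F : T -> {ffun T -> R} -> R) :
  (forall a, a \in s -> convex (F a)) -> convex (fun p => \sum_(a <- s) F a p).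
Proof.
elim: s => [|a s IH] h.
  by apply: affine_convex; apply: (@affine_const 0) => p' _; rewrite big_nil.
apply: (@convex_ext _ (fun p => F a p + \sum_(c <- s) F c p)).
  by move=> p' _; rewrite big_cons.
apply: convexD; first by apply: h; rewrite mem_head.
by apply: IH => c cs; apply: h; rewrite in_cons cs orbT.
Qed.

Definition rest : {set T} := [set~ i] :\ j.

Lemma elsym_rest p' m : same_sum_off i j p p' -> elsym p' rest m = elsym p rest m.
Proof.
move=> [h _]; apply: eq_esym => a; rewrite !inE => /andP[aj ai]; exact: h.
Qed.

(** With [A'] for [A] without [i] and [j], [e_m(A) = e_m(A') + (p i + p j) e_(m-1)(A') + p i p j
    e_(m-2)(A')], and only the last term varies once the sum is fixed. *)
Lemma affine_elsym_both (A : {set T}) m : i \in A -> j \in A -> affine (fun p => elsym p A m).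
Proof.
move=> iA jA; have jA' : j \in A :\ i by rewrite !inE eq_sym ij.
have E p' n : same_sum_off i j p p' -> elsym p' (A :\ i :\ j) n = elsym p (A :\ i :\ j) n.
  move=> [h _]; apply: eq_esym => a; rewrite !inE => /and3P[aj ai _]; exact: h.
case: m => [|[|m]].
- by apply: (@affine_const 1) => p' _; rewrite elsym0.
- apply: (@affine_const (elsym p (A :\ i :\ j) 1 + (p i + p j))) => p' e.
  rewrite (elsymS _ _ iA) (elsymS _ _ jA') !elsym0 E //; case: e => _ <-; ring.
exists (elsym p (A :\ i :\ j) m), (elsym p (A :\ i :\ j) m.+2 + (p i + p j) * elsym p (A :\ i :\ j) m.+1) => p' e.
rewrite (elsymS _ _ iA) !(elsymS _ _ jA') !E //; case: e => _ <-; ring.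
Qed.

End PairwiseShape.

(** * The one-coordinate inequality and its reduction to uniform distributions *)

Section Objective.
Variables (R : realFieldType) (T : finType) (m : nat) (c : R).
Implicit Types (p q : {ffun T -> R}) (D : {set T}).

(* Probability that [m] independent samples from [p] are pairwise distinct and
   all different from [a]. *)
Definition avoid p a : R := m`!%:R * elsym p [set~ a] m.

Definition avoid_mean p : R := (\sum_a avoid p a) / #|T|%:R.

Definition objective p : R := avoid_mean p +
  (\sum_a (avoid p a - avoid_mean p + c * (p a - #|T|%:R^-1)) ^+ 2) / (4%:R * c).

(** For [a] other than [i] and [j] the deviation is affine in the product, so its square is convex.
    At [i] and [j] it is not, because [avoid p i] is linear in [p j] alone and conversely; those two
    squares have to be treated together. *)
Lemma objective_convex p i j : 0 < c -> (0 < m)%N -> i != j -> convex_in_product i j p objective.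
Proof.
move=> c0 m0 ij; have ji : j != i by rewrite eq_sym.
have inc (x y : T) : x != y -> x \in [set~ y] by rewrite !inE.
have [k mk] : exists k, m = k.+1 by exists m.-1; rewrite prednK.
pose w := m`!%:R * elsym p (rest i j) k; pose w1 := m`!%:R * elsym p (rest i j) m.
have Ei p' : same_sum_off i j p p' -> avoid p' i = w1 + w * p' j.
  move=> e; rewrite /avoid mk (elsymS _ _ (inc _ _ ji)) !(elsym_rest _ e) /w /w1 mk; ring.
have rC : [set~ j] :\ i = rest i j by apply/setP => a; rewrite !inE andbC.
have Ej p' : same_sum_off i j p p' -> avoid p' j = w1 + w * p' i.
  move=> e; rewrite /avoid mk (elsymS _ _ (inc _ _ ij)) rC !(elsym_rest _ e) /w /w1 mk; ring.
have Ao a : a != i -> a != j -> affine_in_product i j p (avoid^~ a).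
  by move=> ai aj; apply: affineZ; apply: affine_elsym_both => //; apply: inc; rewrite eq_sym.
have Aij : affine_in_product i j p (fun p => avoid p i + avoid p j).
  apply: (@affine_const _ _ _ _ _ (2 * w1 + w * (p i + p j))) => p' e.
  by rewrite Ei // Ej //; case: e => _ <-; ring.
have Am : affine_in_product i j p avoid_mean.
  apply: (@affine_ext _ _ _ _ _ _ (fun p => #|T|%:R^-1 * ((avoid p i + avoid p j) +
     \sum_(a | (a != i) && (a != j)) avoid p a))).
    by move=> p' _; rewrite /avoid_mean (bigD1 i) //= (bigD1 j) //= addrA mulrC.
  apply: affineZ; apply: affineD => //; apply: affine_sum => a /andP[]; exact: Ao.
pose dev p a := avoid p a - avoid_mean p + c * (p a - #|T|%:R^-1).
have Ado a : a != i -> a != j -> affine_in_product i j p (dev^~ a).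
  move=> ai aj.
  apply: (@affine_ext _ _ _ _ _ _ (fun p => (avoid p a + (-1) * avoid_mean p) + c * (p a - #|T|%:R^-1))).
    by move=> p' _; rewrite /dev; ring.
  apply: affineD; first by apply: affineD; [exact: Ao|exact: affineZ].
  by apply: (@affine_const _ _ _ _ _ (c * (p a - #|T|%:R^-1))) => p' [h _]; rewrite h.
have Cij : convex_in_product i j p (fun p => dev p i ^+ 2 + dev p j ^+ 2).
  (* [dev i + dev j] is affine in the product, and so is the square of
     [dev i - dev j = (c - w) (p i - p j)]. *)
  apply: (@convex_ext _ _ _ _ _ _ (fun p' => 2^-1 * ((dev p' i + dev p' j) ^+ 2 +
     ((c - w) ^+ 2 * ((p i + p j) ^+ 2) + (- 4) * (c - w) ^+ 2 * (p' i * p' j))))).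
    move=> p' e; have [_ <-] := e; rewrite /dev Ei // Ej //.
    by move: (avoid_mean _) (#|T|%:R^-1) => g r; field.
  apply: convexZ; first by rewrite invr_ge0.
  apply: convexD.
    apply: affine_sqr.
    apply: (@affine_ext _ _ _ _ _ _ (fun p' => (avoid p' i + avoid p' j) + (-2) * avoid_mean p'
       + c * (p i + p j - 2 * #|T|%:R^-1))).
      by move=> p' [_ <-]; rewrite /dev; ring.
    apply: affineD; last by apply: (@affine_const _ _ _ _ _ (c * (p i + p j - 2 * #|T|%:R^-1))).
    by apply: affineD => //; apply: affineZ.
  apply: affine_convex; exists (- 4 * (c - w) ^+ 2), ((c - w) ^+ 2 * ((p i + p j) ^+ 2)) => p' _; ring.
apply: (@convex_ext _ _ _ _ _ _ (fun p => avoid_mean p + (4%:R * c)^-1 *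
   ((dev p i ^+ 2 + dev p j ^+ 2) + \sum_(a <- [seq a <- index_enum T | (a != i) && (a != j)]) dev p a ^+ 2))).
  move=> p' _; rewrite /objective -/(dev p' _) (bigD1 i) //= (bigD1 j) //= addrA big_filter.
  by rewrite [X in _ = _ + X]mulrC.
apply: convexD; first exact: affine_convex.
apply: convexZ; first by rewrite invr_ge0 mulr_ge0 // ltW.
apply: convexD => //; apply: convex_sum => a; rewrite mem_filter => /andP[/andP[ai aj] _].
by apply: affine_sqr; apply: Ado.
Qed.

(* [4 c <gamma, y> <= |gamma + c x|^2 - 4 c^2 <x, y> + 4 c^2 |y|^2]: the
   square of [gamma + c x - 2 c y] is nonnegative. *)
Lemma avoid_tangent p q M : 0 < c -> \sum_a p a = 1 -> \sum_a q a = 1 -> objective p <= M ->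
  \sum_a avoid p a * q a <=
    M + c * \sum_a (q a - #|T|%:R^-1) * (q a - p a).
Proof.
move=> c0 p1 q1 hM; apply: le_trans (lerD hM (lexx _)).
have T0 : #|T|%:R != 0 :> R.
  rewrite pnatr_eq0; apply/eqP => /card0_eq T0; move: p1; rewrite big1 => [/eqP|a _].
    by rewrite eq_sym oner_eq0.
  by have := T0 a; rewrite inE.
set b := #|T|%:R in T0 *.
have sb : \sum_(a : T) b^-1 = 1 by rewrite sumr_const -[_ *+ _]mulr_natl mulfV.
have sg : \sum_a (avoid p a - avoid_mean p) = 0.
  rewrite sumrB sumr_const -[_ *+ _]mulr_natl /avoid_mean -/b mulrCA mulfV // mulr1.
  by rewrite subrr.
set G := avoid_mean p in sg *.
rewrite -subr_ge0.
have -> : objective p + c * (\sum_a (q a - b^-1) * (q a - p a)) - \sum_a avoid p a * q a =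
  (\sum_a (avoid p a - G + c * (p a - b^-1) - 2 * c * (q a - b^-1)) ^+ 2) / (4 * c).
  have -> : \sum_a avoid p a * q a = G + \sum_a (avoid p a - G) * (q a - b^-1).
    have E a : (avoid p a - G) * (q a - b^-1) =
      avoid p a * q a - G * q a - b^-1 * (avoid p a - G) by ring.
    under [X in _ = _ + X]eq_bigr => a _ do rewrite E.
    rewrite !sumrB -!mulr_sumr q1 sg; ring.
  rewrite /objective -/G -/b.
  have E a : (avoid p a - G + c * (p a - b^-1) - 2 * c * (q a - b^-1)) ^+ 2 =
     (avoid p a - G + c * (p a - b^-1)) ^+ 2 +
     (4 * c * (c * ((q a - b^-1) * (q a - p a))) - 4 * c * ((avoid p a - G) * (q a - b^-1))) by ring.
  under [X in _ = X / _]eq_bigr => a _ do rewrite E.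
  rewrite big_split sumrB /= -!mulr_sumr; field; exact: lt0r_neq0.
apply: divr_ge0; last by rewrite mulr_ge0 // ltW.
by apply: sumr_ge0 => a _; apply: sqr_ge0.
Qed.

(** Here [u] and [v] are the values of [avoid] at a symbol inside and outside the [k]-element
    support, and [g] is the mean of [avoid]. *)
Definition objective_unif k : R :=
  let b : R := #|T|%:R in
  let u : R := m`!%:R * ('C(k.-1, m)%:R / k%:R ^+ m) in
  let v : R := m`!%:R * ('C(k, m)%:R / k%:R ^+ m) in
  let g := (k%:R * u + (b - k%:R) * v) / b in
  g + (k%:R * (u - g + c * (k%:R^-1 - b^-1)) ^+ 2 +
       (b - k%:R) * (v - g - c * b^-1) ^+ 2) / (4%:R * c).

Lemma objectiveE D : objective (unif R D) = objective_unif #|D|.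
Proof.
have aE a : avoid (unif R D) a = m`!%:R * ('C(if a \in D then #|D|.-1 else #|D|, m)%:R / #|D|%:R ^+ m).
  rewrite /avoid elsym_unif; have -> : #|[set~ a] :&: D| = if a \in D then #|D|.-1 else #|D|.
    have -> : [set~ a] :&: D = D :\ a by apply/setP => x; rewrite !inE.
    by rewrite [in RHS](cardsD1 a D); case: (a \in D).
  by [].
have sD (x y : R) (F : T -> R) : (forall a, F a = if a \in D then x else y) ->
    \sum_a F a = #|D|%:R * x + (#|T|%:R - #|D|%:R) * y.
  move=> h; rewrite (bigID (mem D)) /=.
  rewrite (eq_bigr (fun=> x)); last by move=> a aD; rewrite h aD.
  rewrite [X in _ + X](eq_bigr (fun=> y)); last by move=> a aD; rewrite h (negbTE aD).
  rewrite !sumr_const -[x *+ _]mulr_natl -[y *+ _]mulr_natl; congr (_ + _ * _).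
  have <- : #|~: D| = #|[pred a | a \notin D]| by apply: eq_card => a; rewrite !inE.
  by rewrite -natrB ?max_card // cardsCs finset.setCK.
rewrite /objective_unif /objective.
set u := _ * ('C(#|D|.-1, _)%:R / _); set v := _ * ('C(#|D|, _)%:R / _).
have mE : avoid_mean (unif R D) = (#|D|%:R * u + (#|T|%:R - #|D|%:R) * v) / #|T|%:R.
  by rewrite /avoid_mean (sD u v) // => a; rewrite aE; case: (a \in D).
rewrite mE /=; set g := _ / _; congr (_ + _ / _).
apply: sD => a; rewrite aE ffunE; case: (a \in D) => //.
by rewrite sub0r mulrN.
Qed.

Lemma avoid_bound M : 0 < c -> (0 < m)%N ->
  (forall k, (0 < k <= #|T|)%N -> objective_unif k <= M) ->
  forall p q, in_simplex p -> in_simplex q ->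
  \sum_a avoid p a * q a <= M + c * \sum_a (q a - #|T|%:R^-1) * (q a - p a).
Proof.
move=> c0 m0 h p q ps qs; apply: avoid_tangent => //; [exact: ps.2|exact: qs.2|].
apply: smoothing ps => [p' i j ij|D D0]; first exact: objective_convex.
by rewrite objectiveE; apply: h; rewrite card_gt0 D0 max_card.
Qed.

End Objective.

(** In all three checks [M] is the value at [k = b], where every deviation vanishes, so no smaller
    bound is possible. A point mass, [k = 1], gives [(c / 4) * (1 - 1 / b)], which limits [c] to
    24/25, 4/3 and 4/9 respectively; the choices 9/10, 1 and 2/5 respect this. *)
Lemma objective_unif55 (R : realFieldType) k : (0 < k <= #|'I_5|)%N ->
  objective_unif 'I_5 3 (9%:R / 10%:R : R) k <= 24%:R / 125%:R.
Proof.
rewrite card_ord /objective_unif card_ord.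
by move: k; do 6?[case=> [|]] => //= _; rewrite /binomial /= /factorial /= ?subn0; lra.
Qed.

Lemma objective_unif65 (R : realFieldType) k : (0 < k <= #|'I_6|)%N ->
  objective_unif 'I_6 3 (1 : R) k <= 5%:R / 18%:R.
Proof.
rewrite card_ord /objective_unif card_ord.
by move: k; do 7?[case=> [|]] => //= _; rewrite /binomial /= /factorial /= ?subn0; lra.
Qed.

Lemma objective_unif66 (R : realFieldType) k : (0 < k <= #|'I_6|)%N ->
  objective_unif 'I_6 4 (2%:R / 5%:R : R) k <= 5%:R / 54%:R.
Proof.
rewrite card_ord /objective_unif card_ord.
by move: k; do 7?[case=> [|]] => //= _; rewrite /binomial /= /factorial /= ?subn0; lra.
Qed.

(** * Hansel's lemma for partial colourings *)

Section Hansel.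
Variables (R : realType) (I V T : finType).
Variables (A : I -> {set T}) (f : I -> V -> T) (D : {set V}).
Hypothesis sep : {in D &, forall u v, u != v ->
  exists i, [/\ f i u \in A i, f i v \in A i & f i u != f i v]}.

(* Pick in each [A i] a uniform random element [s i]: the vertices [v] with
   [s i = f i v] whenever [f i v \in A i] are at most one in number. *)
Lemma hansel_weight :
  \sum_(v in D) \prod_i (if f i v \in A i then #|A i|%:R^-1 else 1) <= 1 :> R.
Proof.
(* [None] carries all the mass when [A i] is empty, so that [w i] is a probability distribution in
   every case. *)
pose w i (o : option T) : R := if o is Some a then
  (if a \in A i then #|A i|%:R^-1 else 0) else (A i == finset.set0)%:R.
pose ok i v (o : option T) := (f i v \in A i) ==> (o == Some (f i v)).
have bigO (F : option T -> R) : \sum_o F o = F None + \sum_a F (Some a).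
  rewrite (bigD1 None) //=; congr (_ + _).
  by rewrite (reindex_omap Some id) //=; [apply: eq_bigl => a; rewrite eqxx|case].
have w0 i o : 0 <= w i o by case: o => [a|] /=; rewrite ?ler0n //; case: ifP.
have w1 i : \sum_o w i o = 1.
  rewrite bigO /= -big_mkcond /= (sumr_const (mem (A i))).
  have [A0|A0] := eqVneq (A i) finset.set0; first by rewrite A0 cards0 mulr0n addr0.
  by rewrite add0r -[_ *+ _]mulr_natl mulfV // pnatr_eq0 cards_eq0.
have E i v : (if f i v \in A i then #|A i|%:R^-1 else 1) = \sum_o w i o * (ok i v o)%:R.
  case: ifPn => fA; last first.
    by rewrite -[LHS](w1 i); apply: eq_bigr => o _; rewrite /ok (negbTE fA) mulr1.
  rewrite bigO /ok fA /= mulr0 add0r (bigD1 (f i v)) //= fA eqxx mulr1 big1 ?addr0 // => a af.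
  have /negbTE -> : Some a != Some (f i v) by apply: contra af => /eqP[->].
  by rewrite mulr0.
(* Expanding the product makes the weight of [v] the probability that the random choice [s] is
   compatible with [v]; exchanging the sums leaves the expected number of compatible vertices. *)
under eq_bigr => v _ do (under eq_bigr => i _ do rewrite E; rewrite bigA_distr_bigA /=).
rewrite exchange_big /=.
have S1 : \sum_(s : {ffun I -> option T}) \prod_i w i (s i) = 1.
  by rewrite -bigA_distr_bigA big1.
rewrite -[leRHS]S1; apply: ler_sum => s _; under eq_bigr => v _ do rewrite big_split /=.
rewrite -mulr_sumr ler_piMr ?prodr_ge0 //.
have -> : \sum_(v in D) \prod_i (ok i v (s i))%:R = #|[set v in D | [forall i, ok i v (s i)]]|%:R :> R.
  rewrite -sum1_card natr_sum big_mkcond [RHS]big_mkcond /=; apply: eq_bigr => v _.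
  rewrite inE; case: (v \in D) => //=; case: ifPn => [/forallP h|].
    by rewrite big1 // => i _; rewrite h.
  by rewrite negb_forall => /existsP[i /negbTE h]; rewrite (bigD1 i) //= h mul0r.
rewrite lern1; apply/card_le1_eqP => u v; rewrite !inE => /andP[uD /forallP hu] /andP[vD /forallP hv].
apply/eqP; apply: contraT; rewrite eq_sym => uv.
have [i [fu fv]] := sep uD vD uv.
by move: (hu i) (hv i); rewrite /ok fu fv /= => /eqP-> /eqP[->]; rewrite eqxx.
Qed.

(** The weight of [v] is now [q ^ (- deg v)]. Applying [1 + x <= expR x] around the mean degree,
    where the linear terms cancel in the sum, is Jensen's inequality and yields
    [#|D| <= q ^ (X / #|D|)]. *)
Lemma hansel (q : nat) : (0 < q)%N ->
  (forall i v, v \in D -> f i v \in A i -> #|A i| = q) ->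
  #|D|%:R * ln #|D|%:R <=
    ln q%:R * \sum_i #|[set v in D | f i v \in A i]|%:R :> R.
Proof.
move=> q0 hq; have [->|D0] := eqVneq D finset.set0.
  rewrite cards0 mul0r mulr_ge0 ?sumr_ge0 // ln_ge0 // ler1n //.
have N0 : 0 < #|D|%:R :> R by rewrite ltr0n card_gt0.
set L := ln q%:R; set X := \sum_i _.
pose deg v : R := \sum_i (f i v \in A i)%:R.
have XE : \sum_(v in D) deg v = X.
  rewrite exchange_big /=; apply: eq_bigr => i _.
  rewrite -sum1_card natr_sum big_mkcond [RHS]big_mkcond; apply: eq_bigr => v _.
  by rewrite inE; case: (v \in D) => //=; case: (_ \in _).
have W := hansel_weight.
have WE : {in D, forall v, \prod_i (if f i v \in A i then #|A i|%:R^-1 else 1) = expR (- (deg v * L))}.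
  move=> v vD; rewrite /deg mulr_suml -sumrN expR_sum; apply: eq_bigr => i _.
  case: ifPn => [fA|_]; last by rewrite mul0r oppr0 expR0.
  by rewrite mul1r expRN lnK ?posrE ?ltr0n // (hq _ _ vD fA).
rewrite (eq_bigr _ WE) in W.
have H : #|D|%:R <= \sum_(v in D) expR (X * L / #|D|%:R - deg v * L).
  apply: le_trans (_ : \sum_(v in D) (1 + (X * L / #|D|%:R - deg v * L)) <= _); last first.
    by apply: ler_sum => v _; apply: expR_ge1Dx.
  rewrite big_split sumrB /= -[\sum_(v in D) deg v * L]mulr_suml XE !sumr_const.
  rewrite -[(X * L / _) *+ _]mulr_natl.
  by rewrite [#|D|%:R * _]mulrC divfK ?gt_eqF // subrr addr0.
have {}H : #|D|%:R <= expR (X * L / #|D|%:R).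
  apply: le_trans H _; rewrite -[leRHS]mulr1.
  under eq_bigr => v _ do rewrite expRD.
  by rewrite -mulr_sumr ler_wpM2l // expR_ge0.
have : ln #|D|%:R <= X * L / #|D|%:R by rewrite -ler_expR lnK ?posrE.
by rewrite ler_pdivlMr // mulrC [L * X]mulrC.
Qed.

End Hansel.

Lemma card_ord_lt m n : (m <= n)%N -> #|[pred i : 'I_n | (i < m)%N]| = m.
Proof.
move=> mn; rewrite -sum1_card (eq_bigl (fun i : 'I_n => i < m)%N) //.
by rewrite (big_ord_narrow mn) sum1_card card_ord.
Qed.

Lemma card_ord_geq m n : (m <= n)%N -> #|[pred i : 'I_n | (m <= i)%N]| = (n - m)%N.
Proof.
move=> mn; have := cardC [pred i : 'I_n | (i < m)%N].
rewrite card_ord_lt // card_ord => e.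
rewrite -[X in (X - _)%N]e addKn.
by apply: eq_card => i; rewrite !inE leqNgt.
Qed.

(** A union bound: a sequence of length [n.+1] with a repetition has one of ['C(n.+1, 2)] pairs of
    positions equal, which leaves [m ^ n] choices per pair. *)
Lemma ffact_ge m n : (m ^ n.+1 <= m ^_ n.+1 + 'C(n.+1, 2) * m ^ n)%N.
Proof.
elim: n => [|n IH]; first by rewrite expn1 ffactn1 leq_addr.
rewrite [(m ^ n.+2)%N]expnS ffactnSr binS bin1 mulnDl.
have h : (m ^_ n.+1 <= m ^ n.+1)%N.
  by elim: n.+1 => // k h; rewrite ffactnSr expnSr leq_mul // leq_subr.
have h' : (m ^_ n.+1 * m <= m ^_ n.+1 * (m - n.+1) + n.+1 * m ^_ n.+1)%N.
  by rewrite [(n.+1 * _)%N]mulnC -mulnDr leq_mul2l; apply/orP; right; rewrite addnC -leq_subLR.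
have e : (m ^ n.+1 = m * m ^ n)%N by rewrite expnS.
move: IH h h'; rewrite e; nia.
Qed.

(** * Sampling from random boxes and averaging over them *)

Section Counting.
Variables (R : realType) (b' d n l : nat).
Notation b := b'.+1.
Variable C : {set word b n}.
Hypotheses (hC : is_hash_code d.+3 C) (le_ln : (l <= n)%N) (db : (d.+1 < b)%N).
Local Notation j := d.+1.
Local Notation tuples := {ffun 'I_j -> word b n}.
Implicit Types (B : {set word b n}) (w v x : word b n) (t : tuples) (i : 'I_n).

(* [w] encodes the box whose [i]-th side, for [i < l], is the cyclic interval
   of the [d] symbols [a] with [a + w i < d]; every word lies in [box_mult]
   boxes. *)
Definition in_slot (a u : 'I_b) := ((a + u)%R < d)%N.

Definition box w : {set word b n} :=
  [set x in C | [forall i : 'I_n, (i < l)%N ==> in_slot (x i) (w i)]].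

Definition box_mult : R := d%:R ^+ l * b%:R ^+ (n - l).

(** Membership of [x] is a product of conditions on single coordinates of [w], so the number of
    boxes around [x] factorises: [d] shifts for each of the first [l] coordinates, [b] for each
    other one. *)
Lemma sum_box (F : word b n -> R) :
  \sum_w \sum_(x in box w) F x = box_mult * \sum_(x in C) F x.
Proof.
rewrite mulr_sumr.
transitivity (\sum_(w : word b n) \sum_(x in C) F x *
    \prod_(i < n) ((i < l)%N ==> in_slot (x i) (w i))%:R).
  apply: eq_bigr => w _; rewrite big_mkcond [RHS]big_mkcond; apply: eq_bigr => x _.
  rewrite inE; case: (x \in C) => //=; case: ifPn => [/forallP h|].
    by rewrite big1 ?mulr1 // => i _; rewrite h.
  by rewrite negb_forall => /existsP[i /negbTE h]; rewrite (bigD1 i) //= h mul0r mulr0.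
rewrite exchange_big /=; apply: eq_bigr => x _; rewrite -mulr_sumr mulrC; congr (_ * _).
rewrite -(bigA_distr_bigA (fun i a => ((i < l)%N ==> in_slot (x i) a)%:R)) /=.
rewrite (bigID (fun i : 'I_n => i < l)%N) /=; congr (_ * _).
  rewrite (eq_bigr (fun=> d%:R)) => [|i il].
    by rewrite prodr_const card_ord_lt.
  rewrite il (reindex_inj (addrI (- x i))) /=.
  have e a : in_slot (x i) (- x i + a) = (a < d)%N by rewrite /in_slot addrA subrr add0r.
  under eq_bigr => a _ do rewrite e.
  have db' : (d <= b)%N by lia.
  rewrite -[in RHS](card_ord_lt db') -sumr_const [RHS]big_mkcond; apply: eq_bigr => a _.
  by rewrite inE; case: (a < d)%N.
rewrite (eq_bigr (fun=> b%:R)) => [|i /negbTE il].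
  rewrite prodr_const; congr (_ ^+ _).
  by rewrite -card_ord_geq //; apply: eq_card => i; rewrite /in_mem /= -leqNgt.
by rewrite il /= sumr_const card_ord.
Qed.

Definition hit i t v :=
  injectiveb [ffun r => t r i] && [forall r, t r i != v i].

(** The sample together with two further codewords has [d.+3] elements, so the code property
    separates all of them in some coordinate. By pigeonhole this is not among the first [l], and
    Hansel's lemma applies to the codewords outside the sample. *)
Lemma hansel_tuple w t : injective t -> (forall r, t r \in box w) ->
  (#|C| - j)%:R * ln (#|C| - j)%:R <=
   ln (b - j)%:R * \sum_(i < n | (l <= i)%N) #|[set v in C | hit i t v]|%:R :> R.
Proof.
move=> ti tw; have tC r : t r \in C by have := tw r; rewrite inE => /andP[].
pose X := [set t r | r in 'I_j]; pose D := C :\: X.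
have XC : X \subset C by apply/fintype.subsetP => _ /imsetP[r _ ->].
have cX : #|X| = j by rewrite card_imset // card_ord.
have cD : #|D| = (#|C| - j)%N by rewrite cardsD (finset.setIidPr XC) cX.
(* The symbols left free by the sample, in the coordinates that can still separate; elsewhere the
   empty set makes the coordinate count for no codeword. *)
pose A i : {set 'I_b} := if (l <= i)%N && injectiveb [ffun r => t r i]
  then ~: [set t r i | r in 'I_j] else finset.set0.
have cA i v : v \in D -> v i \in A i -> #|A i| = (b - j)%N.
  rewrite /A; case: ifP => [/andP[_ /injectiveP inj] _ _|_ _]; last by rewrite inE.
  have ti' : injective (fun r => t r i) by move=> r r' e; apply: inj; rewrite !ffunE.
  have := cardsC [set t r i | r in 'I_j]; rewrite card_ord card_imset // card_ord => e.
  by rewrite -[X in (X - _)%N]e addKn.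
have sep : {in D &, forall u v, u != v ->
    exists i, [/\ u i \in A i, v i \in A i & u i != v i]}.
  move=> u v; rewrite !inE => /andP[uX uC] /andP[vX vC] uv.
  have [||i Si] := hC (S := u |: (v |: X)).
  - by apply/fintype.subsetP => y; rewrite !inE => /orP[/eqP->|/orP[/eqP->|/(fintype.subsetP XC)]].
  - by rewrite !cardsU1 cX !inE negb_or uv uX vX.
  have Sin r : t r \in u |: (v |: X) by rewrite !inE imset_f ?orbT.
  have inj : injectiveb [ffun r => t r i].
    by apply/injectiveP => r r'; rewrite !ffunE => e; apply: ti; apply: Si.
  have il : (l <= i)%N.
    rewrite leqNgt; apply/negP => il.
    have h r : ((t r i + w i)%R < d)%N.
      by have := tw r; rewrite inE => /andP[_ /forallP/(_ i)]; rewrite il.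
    have finj : injective (fun r => Ordinal (h r)).
      move=> r r' e; have {}e : (t r i + w i)%R = (t r' i + w i)%R by apply: ord_inj; exact: (congr1 val e).
      by apply: (injectiveP _ inj); rewrite !ffunE; apply: addIr e.
    by have := leq_card _ finj; rewrite !card_ord ltnn.
  have out y : y \in u |: (v |: X) -> y \notin X -> y i \in A i.
    move=> yS yX; rewrite /A il inj inE; apply: contra yX => /imsetP[r _ e].
    by rewrite (Si y (t r)) //; apply: imset_f.
  exists i; split; [apply: out => // | apply: out => // | ].
  - by rewrite !inE eqxx.
  - by rewrite !inE eqxx orbT.
  by apply: contra uv => /eqP e; apply/eqP; apply: Si => //; rewrite !inE eqxx ?orbT.
have b0 : (0 < b - j)%N by rewrite subn_gt0.
rewrite -cD; apply: le_trans (hansel R sep b0 cA) _.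
apply: ler_wpM2l; first by rewrite ln_ge0 // ler1n.
rewrite [leRHS]big_mkcond; apply: ler_sum => i _; case: ifPn => il.
  rewrite ler_nat; apply: subset_leq_card; apply/fintype.subsetP => v; rewrite !inE /A il /=.
  case: ifPn => [inj /andP[/andP[_ vC]]|]; last by rewrite inE andbF.
  rewrite inE vC /hit inj /= => h; apply/forallP => r; apply: contra h => /eqP <-; exact: imset_f.
by rewrite (_ : [set _ in _ | _] = finset.set0) ?cards0 //; apply/setP => v; rewrite !inE /A (negbTE il) inE andbF.
Qed.

Definition count_sym B i : {ffun 'I_b -> R} := [ffun a => #|[set x in B | x i == a]|%:R].

(** Tuples are grouped by their symbols [s] in coordinate [i]: each [s] arises from a product of
    symbol counts, and the admissible [s] are the injective ones avoiding [v i]. *)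
Lemma sum_hit B i v :
  \sum_(t : tuples | t \in ffun_on (mem B)) (hit i t v)%:R =
  avoid j (count_sym B i) (v i).
Proof.
rewrite /avoid -sum_injective_elsym.
rewrite (partition_big (fun t : tuples => [ffun r => t r i]) xpredT) //= [RHS]big_mkcond.
apply: eq_bigr => s _.
have -> : injectiveb s && [forall r, s r \in [set~ v i]] = injectiveb s && [forall r, s r != v i].
  by congr (_ && _); apply: eq_forallb => r; rewrite !inE.
rewrite (eq_bigr (fun=> (injectiveb s && [forall r, s r != v i])%:R)); last first.
  move=> t /andP[_ /eqP e]; rewrite /hit e; congr ((_ && _)%:R).
  by apply: eq_forallb => r; rewrite -e ffunE.
case: ifP => _; last by rewrite big1.
rewrite (eq_bigl (fun t : tuples => t \in family (fun r => [set x in B | x i == s r]))); last first.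
  move=> t; apply/andP/familyP => [[/ffun_onP h /eqP e] r|h].
    by rewrite inE h -e ffunE eqxx.
  split; first by apply/ffun_onP => r; have := h r; rewrite inE => /andP[].
  by apply/eqP/ffunP => r; rewrite ffunE; have := h r; rewrite inE => /andP[_ /eqP].
transitivity (\prod_(r < j) \sum_(x in [set x in B | x i == s r]) (1 : R)).
  by rewrite bigA_distr_big_dep; apply: eq_bigr => t _; rewrite big1.
apply: eq_bigr => r _.
by rewrite sumr_const ffunE.
Qed.

Definition emp B i : {ffun 'I_b -> R} := [ffun a => #|B|%:R^-1 * count_sym B i a].

Lemma sum_count_sym B i (F : 'I_b -> R) :
  \sum_(x in B) F (x i) = \sum_a count_sym B i a * F a.
Proof.
rewrite (partition_big (fun x : word b n => x i) xpredT) //=; apply: eq_bigr => a _.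
rewrite ffunE mulr_natl -sumr_const; apply: eq_big => [x|x /andP[_ /eqP->] //].
by rewrite inE.
Qed.

(** The identity includes the empty set, where both sides vanish, so it can be summed over all
    boxes. *)
Lemma count_symE B i a : count_sym B i a = #|B|%:R * emp B i a.
Proof.
rewrite [in RHS]ffunE; have [->|B0] := eqVneq B finset.set0.
  rewrite cards0 mul0r ffunE (_ : [set _ in _ | _] = finset.set0) ?cards0 //.
  by apply/setP => x; rewrite !inE.
by rewrite mulVKf // pnatr_eq0 cards_eq0.
Qed.

Lemma emp_simplex B i : B != finset.set0 -> in_simplex (emp B i).
Proof.
move=> B0; split=> [a|]; first by rewrite !ffunE mulr_ge0 ?invr_ge0.
under eq_bigr => a _ do rewrite ffunE.
rewrite -mulr_sumr; under eq_bigr => a _ do rewrite -[count_sym _ _ _]mulr1.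
rewrite -(sum_count_sym B i (fun=> 1)) sumr_const mulVf // pnatr_eq0 cards_eq0 //.
Qed.

Variables (c M : R).
Hypothesis bound : forall p q : {ffun 'I_b -> R}, in_simplex p -> in_simplex q ->
  \sum_a avoid j p a * q a <= M + c * \sum_a (q a - #|'I_b|%:R^-1) * (q a - p a).

(** [hansel_tuple] is summed over the injective samples from the box, and its right side is enlarged
    to all tuples. By [ffact_ge] a factor [#|box w| ^ d] cancels; what remains is linear in
    [#|box w|] apart from the weighted empirical distribution, hence easy to sum over boxes. *)
Lemma box_ineq w : C != finset.set0 ->
  (#|C| - j)%:R * ln (#|C| - j)%:R * (#|box w|%:R - 'C(j, 2)%:R) <=
  ln (b - j)%:R * #|C|%:R * \sum_(i < n | (l <= i)%N) (#|box w|%:R * (M + c *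
    \sum_a (emp C i a - #|'I_b|%:R^-1) * (emp C i a - emp (box w) i a))).
Proof.
move=> C0; set K0 := (#|C| - j)%:R * _; set s := #|box w|.
have K00 : 0 <= K0.
  by rewrite /K0; case: (#|C| - j)%N => [|k]; rewrite ?mul0r // mulr_ge0 // ln_ge0 // ler1n.
(* An empty box has no empirical distribution, but there the right side is zero and the left side is
   not positive. *)
have [s0|s0] := posnP s.
  rewrite s0 [X in _ <= _ * X]big1 ?mulr0 => [|i _]; last by rewrite mul0r.
  by rewrite sub0r mulrN oppr_le0 mulr_ge0.
have B0 : box w != finset.set0 by rewrite -card_gt0.
have sR : 0 < s%:R :> R by rewrite ltr0n.
have sum1 : K0 * (s ^_ j)%:R <= ln (b - j)%:R * (\sum_(i < n | (l <= i)%N)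
     \sum_(v in C) avoid j (count_sym (box w) i) (v i)).
  have -> : (s ^_ j)%:R = \sum_(t in [set f in ffun_on (mem (box w)) | injectiveb (f : tuples)]) 1 :> R.
    by rewrite sumr_const card_inj_ffuns_on card_ord.
  under [X in _ <= _ * X]eq_bigr => i _ do (under eq_bigr => v _ do rewrite -sum_hit;
    rewrite exchange_big /=).
  rewrite exchange_big /= !mulr_sumr big_mkcond [leRHS]big_mkcond /=; apply: ler_sum => t _.
  rewrite inE; case: ifPn => [/andP[tb /injectiveP ti]|_]; last first.
    case: ifP => // _; rewrite mulr_ge0 ?ln_ge0 ?sumr_ge0 // => [|i _]; last exact: sumr_ge0.
    by rewrite ler1n subn_gt0.
  rewrite tb mulr1; apply: le_trans (hansel_tuple ti (ffun_onP tb)) _.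
  apply: ler_wpM2l; first by rewrite ln_ge0 // ler1n subn_gt0.
  apply: ler_sum => i _; rewrite -sum1_card natr_sum big_mkcond [leRHS]big_mkcond.
  by apply: ler_sum => v _; rewrite inE; case: (v \in C) => //=; case: (hit _ _ _).
have av i a : avoid j (count_sym (box w) i) a = s%:R ^+ j * avoid j (emp (box w) i) a.
  rewrite /avoid mulrCA -elsym_scale; congr (_ * elsym _ _ _).
  by apply/ffunP => x; rewrite [RHS]ffunE count_symE.
have sum2 i : \sum_(v in C) avoid j (count_sym (box w) i) (v i) =
    s%:R ^+ d * (#|C|%:R * (s%:R * \sum_a avoid j (emp (box w) i) a * emp C i a)).
  rewrite (sum_count_sym C i (avoid j _)) !mulr_sumr; apply: eq_bigr => a _.
  rewrite av count_symE exprS; ring.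
rewrite (eq_bigr _ (fun i _ => sum2 i)) in sum1.
rewrite -(ler_pM2l (exprn_gt0 d sR)).
apply: le_trans (_ : K0 * (s ^_ j)%:R <= _).
  rewrite mulrCA; apply: ler_wpM2l => //; rewrite mulrBr lerBlDr -exprSr -!natrX -natrM -natrD ler_nat.
  by rewrite [(_ ^ d * _)%N]mulnC; apply: ffact_ge.
apply: le_trans sum1 _; rewrite -!mulr_sumr [leRHS]mulrCA -[leRHS]mulrA.
apply: ler_wpM2l; first by rewrite ln_ge0 // ler1n subn_gt0.
rewrite mulrCA; do 3!(apply: ler_wpM2l; rewrite ?exprn_ge0 ?ler0n //).
by apply: ler_sum => i _; apply: bound; apply: emp_simplex.
Qed.

(** Summing [box_ineq] over all [w]: weighted by box sizes, the empirical distributions of the boxes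
    average to that of [C], which cancels the term with factor [c]. *)
Lemma code_ineq :
  (#|C| - j)%:R * ln (#|C| - j)%:R * (box_mult * #|C|%:R - b%:R ^+ n * 'C(j, 2)%:R) <=
  ln (b - j)%:R * (n - l)%:R * (box_mult * #|C|%:R ^+ 2 * M).
Proof.
have [->|C0] := eqVneq C finset.set0.
  by rewrite cards0 sub0n !mul0r expr0n !(mulr0,mul0r).
have sb : \sum_w #|box w|%:R = box_mult * #|C|%:R.
  by rewrite -sumr_const -sum_box; apply: eq_bigr => w _; rewrite sumr_const.
have se i a : \sum_w #|box w|%:R * emp (box w) i a = box_mult * #|C|%:R * emp C i a.
  rewrite -mulrA -count_symE; under eq_bigr => w _ do rewrite -count_symE.
  have ec B : count_sym B i a = \sum_(x in B) (x i == a)%:R.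
    rewrite (sum_count_sym B i (fun y => (y == a)%:R)) (bigD1 a) //= eqxx mulr1 big1 ?addr0 // => y /negbTE ->.
    by rewrite mulr0.
  by rewrite ec -sum_box; apply: eq_bigr => w _; rewrite ec.
have := ler_sum (index_enum (word b n)) (fun w (_ : xpredT w) => box_ineq w C0).
rewrite -mulr_sumr sumrB sb sumr_const card_ffun !card_ord -[_ *+ (_ ^ _)%N]mulr_natl natrX.
move=> h; apply: le_trans h _; rewrite -mulr_sumr exchange_big /=.
rewrite -!mulrA; apply: ler_wpM2l; first by rewrite ln_ge0 // ler1n subn_gt0.
rewrite (eq_bigr (fun=> box_mult * #|C|%:R * M)) => [|i _]; last first.
  under eq_bigr => w _ do rewrite mulrDr.
  rewrite big_split /= -mulr_suml sb [X in _ + X](_ : _ = 0) ?addr0 //.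
  under eq_bigr => w _ do rewrite mulrCA mulr_sumr.
  rewrite -mulr_sumr exchange_big /= big1 ?mulr0 // => a _.
  under eq_bigr => w _ do rewrite mulrCA mulrBr.
  by rewrite -mulr_sumr sumrB se -mulr_suml sb subrr mulr0.
rewrite sumr_const -[(_ * M) *+ _]mulr_natl.
have -> : #|[pred i : 'I_n | (l <= i)%N]| = (n - l)%N.
  exact: card_ord_geq.
rewrite le_eqVlt; apply/orP; left; apply/eqP; rewrite /box_mult; ring.
Qed.

End Counting.

Lemma expRN1_le_half (R : realType) : expR (- 1) <= 2^-1 :> R.
Proof.
rewrite expRN lef_pV2 ?posrE ?expR_gt0 //.
by apply: le_trans (expR_ge1Dx 1); lra.
Qed.

(** * From the counting inequality to the asymptotic rate *)

Section Asymptotics.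
Variables (R : realType) (b' d : nat) (c M : R).
Notation b := b'.+1.
Local Notation j := d.+1.
Hypotheses (d0 : (0 < d)%N) (db : (d.+2 < b)%N) (M0 : 0 < M).
Hypothesis bound : forall p q : {ffun 'I_b -> R}, in_simplex p -> in_simplex q ->
  \sum_a avoid j p a * q a <= M + c * \sum_a (q a - #|'I_b|%:R^-1) * (q a - p a).

Let lam : R := ln (b%:R / d%:R).
Let mu : R := M * ln (b - j)%:R.
(** The common value of [l * lam / n] and [(n - l) * mu / n] at the balanced [l]. Boxes stay large
    while [l * lam] is below [ln #|C|], and the counting inequality then gives roughly
    [ln #|C| <= (n - l) * mu]. *)
Let rho := mu * lam / (mu + lam).

Lemma lam_gt0 : 0 < lam.
Proof. by rewrite ln_gt0 // ltr_pdivlMr ?ltr0n // mul1r ltr_nat; lia. Qed.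

Lemma mu_gt0 : 0 < mu.
Proof. by rewrite mulr_gt0 // ln_gt0 // ltr1n; lia. Qed.

Lemma rho_gt0 : 0 < rho.
Proof. apply: divr_gt0; [apply: mulr_gt0|apply: addr_gt0]; by [exact: mu_gt0|exact: lam_gt0]. Qed.

(* [l] is chosen so that [(b / d) ^ l] is about [exp (n rho)], which is
   exponentially smaller than a code of rate above [rho]. *)
Lemma ln_code_le (eps : R) n : 0 < eps ->
  1 + mu + (j + 'C(j, 2))%:R * ((rho + eps) / eps + 2) < n%:R * eps ->
  forall C : {set word b n}, is_hash_code d.+3 C ->
  ln #|C|%:R <= n%:R * (rho + eps).
Proof.
move=> e0 hn C hC; rewrite leNgt; apply/negP => hN.
have mu0 := mu_gt0; have lam0 := lam_gt0; have rho0 := rho_gt0.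
have ml0 : 0 < mu + lam by rewrite addr_gt0.
set S : R := (j + 'C(j, 2))%:R in hn.
have jS : j%:R <= S by rewrite /S natrD lerDl.
have JS : ('C(j, 2))%:R <= S by rewrite /S natrD lerDr.
have j1 : 1 <= j%:R :> R by rewrite ler1n.
have J0 : 0 <= ('C(j, 2))%:R :> R by [].
have re0 : 0 < (rho + eps) / eps by rewrite divr_gt0 // addr_gt0.
have S1 : 1 <= S by lra.
have nS : 2 * S + 1 < n%:R * eps.
  have : 0 <= S * ((rho + eps) / eps) by rewrite mulr_ge0; lra.
  lra.
have N0 : 0 < #|C|%:R :> R.
  rewrite ltr0n lt0n; apply/negP => /eqP E; move: hN; rewrite E ln0 // ltNge.
  by rewrite mulr_ge0 // addr_ge0 ?ltW.
set N : R := #|C|%:R in hN N0.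
(* The exponential gap: a code exceeding the claimed size satisfies [expR (n rho) <= x N]. The
   relative losses from the [j] removed words and from repeated samples are at most [x * j] and
   [x * 'C(j, 2)]. *)
pose x := expR (- (n%:R * eps)).
have x0 : 0 < x by apply: expR_gt0.
have xn : x * (n%:R * eps) <= 1.
  rewrite /x expRN mulrC ler_pdivrMr ?expR_gt0 // mul1r.
  by apply: le_trans (expR_ge1Dx _); lra.
have xS : x * S <= 2^-1.
  have : x * (2 * S) <= x * (n%:R * eps) by rewrite ler_wpM2l // ltW //; lra.
  lra.
have xj : x * j%:R <= 2^-1 by apply: le_trans xS; rewrite ler_wpM2l // ltW.
have xJ : x * 'C(j, 2)%:R <= 2^-1 by apply: le_trans xS; rewrite ler_wpM2l // ltW.
have NE : expR (n%:R * (rho + eps)) <= N.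
  by rewrite -[leRHS]lnK ?posrE // ler_expR ltW.
have xN : expR (n%:R * rho) <= x * N.
  apply: le_trans (_ : x * expR (n%:R * (rho + eps)) <= _); last by rewrite ler_pM2l.
  by rewrite -expRD ler_expR; lra.
set y := n%:R * mu / (mu + lam).
have y0 : 0 <= y by apply: divr_ge0; [apply: mulr_ge0; [exact: ler0n|exact: ltW]|exact: ltW].
(* [y] satisfies [y lam = (n - y) mu = n rho]. Rounding down keeps [(b / d) ^ l] below
   [expR (n rho)] and adds at most one coordinate to [n - y], hence the extra [mu] in [mul_le]. *)
pose l := Num.truncn y.
have /andP[ly yl] : l%:R <= y < l.+1%:R by apply: truncn_itv.
have le_ln : (l <= n)%N.
  rewrite -(ler_nat R); apply: le_trans ly _; rewrite ler_pdivrMr // ler_wpM2l //; lra.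
have xN1 : 1 <= x * N.
  by apply: le_trans xN; rewrite -expR0 ler_expR mulr_ge0 // ltW.
have T_le : (b%:R / d%:R) ^+ l <= x * N.
  apply: le_trans xN.
  have bd0 : 0 < b%:R / d%:R :> R by rewrite divr_gt0 ?ltr0n.
  rewrite -[b%:R / d%:R]lnK ?posrE // -/lam -expRM_natl ler_expR.
  apply: le_trans (_ : y * lam <= _); first by rewrite ler_pM2r.
  by rewrite /y /rho le_eqVlt; apply/orP; left; apply/eqP; field; lra.
have := code_ineq hC le_ln (ltnW db) bound.
set K := box_mult R b' d n l.
have K0 : 0 < K by rewrite mulr_gt0 // exprn_gt0 // ltr0n.
have -> : b%:R ^+ n = K * (b%:R / d%:R) ^+ l.
  have dl : d%:R ^+ l != 0 :> R by rewrite expf_neq0 // pnatr_eq0 -lt0n.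
  rewrite /K /box_mult expr_div_n [d%:R ^+ l * _]mulrC -mulrA [d%:R ^+ l * _]mulrC divfK //.
  by rewrite -exprD subnK.
set T := (_ / _) ^+ l in T_le *; rewrite -/N.
set Z := (_ - _)%:R.
have ZE : N * (1 - x * j%:R) <= Z.
  have jN : j%:R <= x * N * j%:R by rewrite ler_peMl.
  have jC : (j <= #|C|)%N.
    rewrite -(ler_nat R); apply: le_trans jN _.
    have : N * (x * j%:R) <= N * 2^-1 by rewrite ler_pM2l.
    rewrite -/N; lra.
  by rewrite /Z natrB // -/N; lra.
have Zh : N * 2^-1 <= Z by apply: le_trans ZE; rewrite ler_pM2l //; lra.
(* A lower bound for [ln Z]: the 1 pays for [Z] being only known to be at least [N / 2], as
   [expR (- 1) <= 1 / 2]. *)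
pose Y := n%:R * (rho + eps) - 1.
have Y0 : 0 <= Y by have : 0 <= n%:R * rho by [rewrite mulr_ge0 // ltW]; rewrite /Y; lra.
have Z0 : 0 < Z by lra.
have YZ : Y <= ln Z.
  rewrite -ler_expR lnK ?posrE // /Y expRD; apply: le_trans Zh.
  by apply: ler_pM; rewrite ?expR_ge0 // expRN1_le_half.
move=> H; have {}H : Z * ln Z * (N - 'C(j, 2)%:R * T) <= (mu * (n - l)%:R) * N ^+ 2.
  rewrite -(ler_pM2l K0).
  have -> : K * (Z * ln Z * (N - 'C(j, 2)%:R * T)) =
     Z * ln Z * (K * N - K * T * 'C(j, 2)%:R) by ring.
  by apply: le_trans H _; rewrite /mu le_eqVlt; apply/orP; left; apply/eqP; ring.
have mul_le : mu * (n - l)%:R <= n%:R * rho + mu.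
  apply: le_trans (_ : mu * (n%:R - y + 1) <= _).
    rewrite ler_pM2l // natrB //; move: yl; rewrite -natr1; lra.
  by rewrite le_eqVlt; apply/orP; left; apply/eqP; rewrite /y /rho; field; lra.
have TJ : N * (1 - x * 'C(j, 2)%:R) <= N - 'C(j, 2)%:R * T.
  have : 'C(j, 2)%:R * T <= 'C(j, 2)%:R * (x * N) by rewrite ler_wpM2l.
  lra.
have low : (N * (1 - x * j%:R)) * Y * (N * (1 - x * 'C(j, 2)%:R)) <= Z * ln Z * (N - 'C(j, 2)%:R * T).
  have n1 : 0 <= N * (1 - x * j%:R) by rewrite mulr_ge0 ?ltW //; lra.
  have n2 : 0 <= N * (1 - x * 'C(j, 2)%:R) by rewrite mulr_ge0 ?ltW //; lra.
  by apply: ler_pM => //; [rewrite mulr_ge0|apply: ler_pM].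
have {low} H2 : (1 - x * j%:R) * (1 - x * 'C(j, 2)%:R) * Y <= n%:R * rho + mu.
  have NN : 0 < N ^+ 2 by rewrite exprn_gt0.
  rewrite -(ler_pM2r NN).
  apply: le_trans (_ : (mu * (n - l)%:R) * N ^+ 2 <= _); last by rewrite ler_pM2r.
  by apply: le_trans H; apply: le_trans low; rewrite le_eqVlt; apply/orP; left; apply/eqP; ring.
(* Since [x * (n eps) <= 1], the total loss [S * (x * Y)] stays bounded in [n], so the surplus
   [n eps] eventually exceeds it and contradicts [H2]. *)
have xY : x * Y <= (rho + eps) / eps.
  apply: le_trans (_ : x * (n%:R * (rho + eps)) <= _).
    by rewrite ler_pM2l // /Y; lra.
  have -> : x * (n%:R * (rho + eps)) = (x * (n%:R * eps)) * ((rho + eps) / eps) by field; lra.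
  by rewrite ler_piMl // ltW.
have SE : S = j%:R + 'C(j, 2)%:R by rewrite /S natrD.
have p1 : 0 <= (x * j%:R) * (x * 'C(j, 2)%:R) * Y by rewrite !mulr_ge0 // ltW.
have p2 : S * (x * Y) <= S * ((rho + eps) / eps) by rewrite ler_wpM2l //; lra.
have e1 : (1 - x * j%:R) * (1 - x * 'C(j, 2)%:R) * Y =
  Y - S * (x * Y) + (x * j%:R) * (x * 'C(j, 2)%:R) * Y by rewrite SE; ring.
rewrite e1 in H2.
have YE : Y = n%:R * rho + n%:R * eps - 1 by rewrite /Y mulrDr.
lra.
Qed.

Lemma R_hash_le (r : R) : rho <= r * ln 2 -> (R_hash R b d.+3 <= r%:E)%E.
Proof.
move=> hr; apply/lee_addgt0Pr => e e0.
have l2 : 0 < ln 2 :> R by rewrite ln_gt0 // ltr1n.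
pose eps := e * ln 2; have eps0 : 0 < eps by rewrite mulr_gt0.
pose B := 1 + mu + (j + 'C(j, 2))%:R * ((rho + eps) / eps + 2).
pose n0 := (Num.truncn (B / eps)).+1.
have hn n : (n0 <= n)%N -> B < n%:R * eps.
  move=> h; rewrite -ltr_pdivrMr //; apply: lt_le_trans (_ : n0%:R <= _); last by rewrite ler_nat.
  exact: truncnS_gt.
have u_le n : (n0 <= n)%N -> ln (N_hash b d.+3 n)%:R / ln 2 / n%:R <= r + e.
  move=> h; have n_gt0 : 0 < n%:R :> R by rewrite ltr0n; apply: leq_trans h.
  rewrite ler_pdivrMr // ler_pdivrMr // /N_hash.
  apply: le_trans (_ : n%:R * (rho + eps) <= _); last first.
    rewrite -mulrA mulrCA ler_pM2l // mulrDl; exact: lerD.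
  (* The maximum is seeded with 0, where the convention that [ln] vanishes at 0 keeps the bound
     true. *)
  apply: (big_ind (fun m : nat => ln m%:R <= n%:R * (rho + eps) :> R)).
  - by rewrite ln0 // mulr_ge0 // addr_ge0 // ltW // rho_gt0.
  - by move=> m m' h1 h2; rewrite /maxn; case: ifP.
  by move=> C /asboolP; apply: ln_code_le => //; apply: hn.
rewrite /R_hash limn_esup_lim; apply: lime_le; first exact: is_cvg_esups.
exists n0 => // m /= hm; apply: ge_ereal_sup => _ [k /= hk <-].
by rewrite -EFinD lee_fin; apply: u_le; apply: leq_trans hk.
Qed.

End Asymptotics.

(** * Numerical evaluation of the three rates *)

Lemma harmonic_rate_le (R : realFieldType) (mu lam r y : R) :
  0 < mu -> 0 < lam -> mu * lam <= r * y * (mu + lam) -> mu * lam / (mu + lam) <= r * y.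
Proof. by move=> mu0 lam0 h; rewrite ler_pdivrMr // addr_gt0. Qed.

Unset Implicit Arguments.
Local Open Scope ereal_scope.

Theorem theorem2 (R : realType) :
  [/\ R_hash R 5 5 <= ((1689325%:R / 10000000%:R : R))%:E,
      R_hash R 6 5 <= ((3451130%:R / 10000000%:R : R))%:E
    & R_hash R 6 6 <= ((5%:R / 59%:R : R))%:E].
Proof.
have l2 : (0 < ln (2%:R : R))%R by rewrite ln_gt0 // ltr1n.
split.
- apply: (@R_hash_le R 4 2 (9%:R / 10%:R) (24%:R / 125%:R)) => //.
    by apply: avoid_bound => //; exact: objective_unif55.
  (* [(5/2)^3 = 125/8 < 16], so [lam <= (4/3) ln 2]; with [mu = (24/125) ln 2] the rate is at most
     [24/143 < 0.16784]. *)
  have h : (3%:R * ln (5%:R / 2%:R) <= 4%:R * ln 2 :> R)%R.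
    by rewrite ![(_ * ln _)%R]mulr_natl -!lnXn ?ler_ln ?posrE ?exprn_gt0 //; lra.
  have h0 : (0 < ln (5%:R / 2%:R : R))%R by rewrite ln_gt0 //; lra.
  rewrite (_ : (5 - 3)%N = 2%N) //; apply: harmonic_rate_le => //; first by rewrite mulr_gt0 //; lra.
  set x := ln (5%:R / 2%:R) in h h0 *; set y := ln _ in l2 h *.
  by nra.
- apply: (@R_hash_le R 5 2 1 (5%:R / 18%:R)) => //.
    by apply: avoid_bound => //; exact: objective_unif65.
  (* From [3^29 <= 2^46]. Here [lam = ln 3] and [mu = (5/18) lam], so the rate is
     [(5/23) log_2 3 <= 10/29 < 0.34483]. *)
  have h : (29%:R * ln (6%:R / 2%:R) <= 46%:R * ln 2 :> R)%R.
    by rewrite ![(_ * ln _)%R]mulr_natl -!lnXn ?ler_ln ?posrE ?exprn_gt0 //; lra.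
  have h0 : (0 < ln (6%:R / 2%:R : R))%R by rewrite ln_gt0 //; lra.
  have e : ln (6 - 3)%:R = ln (6%:R / 2%:R : R) by congr ln; rewrite (_ : (6 - 3)%N = 3%N) //; lra.
  rewrite e; apply: harmonic_rate_le => //; first by rewrite mulr_gt0 //; lra.
  set x := ln (6%:R / 2%:R) in h h0 *; set y := ln _ in l2 h *.
  by nra.
apply: (@R_hash_le R 5 3 (2%:R / 5%:R) (5%:R / 54%:R)) => //.
  by apply: avoid_bound => //; exact: objective_unif66.
(* Both logarithms equal [ln 2], so the rate is exactly [(5/54) / (59/54) = 5/59]. *)
rewrite (_ : (6 - 4)%N = 2%N) // (_ : 6%:R / 3%:R = 2%:R :> R)%R; last by lra.
apply: harmonic_rate_le => //; first by rewrite mulr_gt0 //; lra.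
by set y := ln _ in l2 *; nra.
Qed.
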